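(* Let $\mathfrak{B}$ be a bornology with a compact base $\mathfrak{B}_0$ on a topological space $X$, and let $\Pi\in\{S_1,S_{fin}\}$. The following are equivalent. (1) $X$ satisfies $\Pi(\mathcal{O}_{\mathfrak{B}},\mathcal{O}_{\mathfrak{B}})$. (2) $X^n$ satisfies $\Pi(\mathcal{O}_{\mathfrak{B}^n},\mathcal{O}_{\mathfrak{B}^n})$ for every integer $n\ge 1$.
   Context: A bornology $\mathfrak{B}$ on a space $X$ is a family of subsets of $X$ that is closed under taking subsets and finite unions and covers $X$; by standing convention $X\notin\mathfrak{B}$. A base of $\mathfrak{B}$ is a subfamily $\mathfrak{B}_0\subseteq\mathfrak{B}$ such that every $B\in\mathfrak{B}$ is contained in some $B_0\in\mathfrak{B}_0$; it is compact if its members are compact subsets of $X$. $\mathfrak{B}^n$ denotes the bornology on $X^n$ generated by $\{B^n:B\in\mathfrak{B}\}$. For a bornology $\mathfrak{C}$ on a space $Y$, $\mathcal{O}_{\mathfrak{C}}$ is the collection of all open $\mathfrak{C}$-covers of $Y$: families $\mathcal{U}$ of open subsets of $Y$ with $Y\notin\mathcal{U}$ such that every $C\in\mathfrak{C}$ is contained in some $U\in\mathcal{U}$. $S_1(\mathcal{A},\mathcal{B})$ means that for each sequence $\{\mathcal{U}_k:k\in\omega\}$ of elements of $\mathcal{A}$ there are $V_k\in\mathcal{U}_k$ with $\{V_k:k\in\omega\}\in\mathcal{B}$. $S_{fin}(\mathcal{A},\mathcal{B})$ means that for each such sequence there are finite (possibly empty) $\mathcal{V}_k\subseteq\mathcal{U}_k$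 with $\bigcup_{k\in\omega}\mathcal{V}_k\in\mathcal{B}$. *)

(* Defs.v *)
From mathcomp Require Import all_boot all_classical.
From mathcomp Require Import topology function_spaces.
Set Implicit Arguments.
Unset Strict Implicit.
Unset Printing Implicit Defensive.
Local Open Scope classical_set_scope.

(* The finite family [F] may be empty, so the empty set is always a member. *)
Definition is_bornology (T : Type) (B : set (set T)) : Prop :=
  [/\ forall A A' : set T, B A -> A' `<=` A -> B A',
      forall F : set (set T),
        finite_set F -> F `<=` B -> B (\bigcup_(A in F) A),
      \bigcup_(A in B) A = setT
    & ~ B setT].

Definition is_bornology_base (T : Type) (B B0 : set (set T)) : Prop :=
  B0 `<=` B /\ (forall A, B A -> exists2 A0, B0 A0 & A `<=` A0).

Definition is_compact_family (X : topologicalType) (B0 : set (set X)) : Prop :=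
  forall A, B0 A -> compact A.

Definition power_space (X : topologicalType) (n : nat) : topologicalType :=
  prod_topology (fun _ : 'I_n => X).

Definition set_power (X : topologicalType) (n : nat) (A : set X) :
    set (power_space X n) :=
  [set f | forall i : 'I_n, A (f i)].
Arguments set_power {X} n A.

Definition power_bornology (X : topologicalType) (n : nat) (B : set (set X)) :
    set (set (power_space X n)) :=
  smallest (@is_bornology (power_space X n)) [set set_power n A | A in B].
Arguments power_bornology {X} n B.

Definition open_covers (Y : topologicalType) (C : set (set Y)) :
    set (set (set Y)) :=
  [set U | [/\ U `<=` open, ~ U setT
             & forall A, C A -> exists2 V, U V & A `<=` V]].

Variant selection_principle := S1 | Sfin.

Definition satisfies (Pi : selection_principle) (E : Type)
    (A B : set (set E)) : Prop :=
  match Pi with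
  | S1 => forall U : nat -> set E, (forall k, A (U k)) ->
      exists V : nat -> E, (forall k, U k (V k)) /\ B (range V)
  | Sfin => forall U : nat -> set E, (forall k, A (U k)) ->
      exists V : nat -> set E,
        (forall k, finite_set (V k) /\ V k `<=` U k) /\ B (\bigcup_k V k)
  end.

(* Main.v *)
Require Import Defs.
From mathcomp Require Import all_boot all_classical.
From mathcomp Require Import topology function_spaces.
Local Open Scope classical_set_scope.
Set Implicit Arguments.
Unset Strict Implicit.

(** Both implications are instances of one transfer principle.  Suppose that a
    monotone operation [p] carries subsets of [Y] to subsets of [Z], that the
    sets [p K] with [K] in [C] absorb every member of [D], and that a tube
    lemma holds: each [K] in [C] has a companion [A] in [D] such that every
    open [W] around [A] contains [p V] for some open [V] around [K].  Given a
    sequence of open [D]-covers of [Z], replace each cover by the family of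
    open sets [V] such that [p V] lies inside one of its members; the tube
    lemma makes this an open [C]-cover of [Y], from which [Y] itself is absent
    because [p] carries [Y] onto all of [Z].  A selection made there is
    pushed to [Z] by choosing, for each selected [V], a member around [p V],
    and the absorption property shows that the result still covers [D]
    ([satisfies_transfer]).

    To pass from [X] to its powers, let [p] be the formation of [n]-th powers.
    The powers of members of the bornology absorb the whole power bornology
    ([power_bornologyE]), and the tube lemma is a Wallace-type theorem
    ([compact_power_tube]): an open set around the power of a compact [K]
    contains the power of an open set around [K].  This is the only place
    where compactness enters.

    To come back from a power to [X], let [p] be the preimage under the
    diagonal.
    The tube lemma is then immediate, because the power of an open set is open
    and its preimage under the diagonal is the set itself. *)

(** * Boxes in finite products *)

Lemma open_box (I : finType) (T : I -> topologicalType)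
    (O : forall i, set (T i)) :
  (forall i, open (O i)) ->
  open ([set f | forall i, O i (f i)] : set (prod_topology T)).
Proof.
move=> oO; rewrite openE => f Of; rewrite /interior.
apply: (@filter_forall _ _ (fun i (g : prod_topology T) => O i (g i))
  (nbhs f)) => i.
apply: (@proj_continuous I T i f); apply: open_nbhs_nbhs.
by split; [exact: oO | exact: Of].
Qed.

(** The sets that contain an open box around [f] form a filter, and this filter
    converges to [f] in each of the initial topologies that generate the
    product topology; hence it converges to [f] in their supremum. *)
Lemma nbhs_box (I : finType) (T : I -> topologicalType) (f : prod_topology T)
    (W : set (prod_topology T)) :
  nbhs f W ->
  exists2 O : forall i, set (T i), forall i, open_nbhs (f i) (O i)
    & [set g | forall i, O i (g i)] `<=` W.
Proof.
pose F : set (set (prod_topology T)) :=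
  [set W | exists2 O : forall i, set (T i), forall i, open_nbhs (f i) (O i)
    & [set g | forall i, O i (g i)] `<=` W].
have FF : Filter F.
  split.
  - exists (fun _ => setT) => // i; split => //; exact: openT.
  - move=> P Q [O fO OP] [O' fO' OQ]; exists (fun i => O i `&` O' i).
      by move=> i; apply: open_nbhsI.
    by move=> g Og; split; [apply: OP | apply: OQ] => i; have [] := Og i.
  - by move=> P Q PQ [O fO OP]; exists O => //; apply: subset_trans PQ.
suff : cvg_to F (nbhs f) by apply.
apply/cvg_sup => i A; rewrite nbhsE => -[V [[O oO <-] Of] VA].
exists (dfwith (fun=> setT) i O) => [j|g Og].
  by case: dfwithP => // k _; split => //; exact: openT.
by apply: VA; have := Og i; rewrite dfwithin.
Qed.

(** Apply the near-covering form of compactness to the finite lists of points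
    of [K], filtered by inclusion: every list that contains [x] takes
    care of the neighborhood [N x], so some list takes care of all of [K]. *)
Lemma compact_nbhs_subcover (T : topologicalType) (K : set T)
    (N : T -> set T) :
  compact K -> (forall x, K x -> nbhs x (N x)) ->
  exists2 s : seq T, {in s, forall x, K x}
    & forall y, K y -> exists2 x, x \in s & N x y.
Proof.
move=> /compact_near_coveringP cK KN.
pose F : set (set (seq T)) := [set S | exists2 s : seq T,
  {in s, forall x, K x} & forall s' : seq T, {subset s <= s'} -> S s'].
have FF : Filter F.
  split.
  - by exists [::].
  - move=> P Q [s sK sP] [t tK tQ]; exists (s ++ t).
      by move=> x; rewrite mem_cat => /orP[/sK|/tK].
    move=> s' sts'; split; [apply: sP | apply: tQ] => x xs; apply: sts';
      by rewrite mem_cat xs ?orbT.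
  - by move=> P Q PQ [s sK sP]; exists s => // s' /sP /PQ.
have [x Kx|s sK sP] := cK _ F (fun s y => exists2 x, x \in s & N x y) FF.
  exists (N x, [set s | x \in s]); last by move=> [y s] [/= Ny xs]; exists x.
  split; first exact: KN.
  exists [:: x] => [y|s]; first by rewrite inE => /eqP ->.
  by apply; rewrite inE.
by exists s => //; exact: sP.
Qed.

(** Cover the compact power of [K] by finitely many boxes inside [W].  Each
    point [x] of [K] has the neighborhood formed by the points that lie in
    every side containing [x] of every one of these boxes; the union of these
    neighborhoods is the desired [U].  Indeed, let the coordinates of [y] be
    close in this sense to points [x i] of [K]; the tuple [x] lies in one of
    the boxes, so [y] lies in the same box. *)
Lemma compact_power_tube (X : topologicalType) (n : nat) (K : set X)
    (W : set (power_space X n)) :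
  compact K -> open W -> set_power n K `<=` W ->
  exists U : set X, [/\ open U, K `<=` U & set_power n U `<=` W].
Proof.
move=> cK oW KW.
have box f : exists O : 'I_n -> set X, set_power n K f ->
    (forall i, open_nbhs (f i) (O i)) /\ [set g | forall i, O i (g i)] `<=` W.
  have [Kf|nKf] := pselect (set_power n K f); last by exists (fun=> set0).
  have [|O fO OW] := @nbhs_box _ (fun=> X) f W; last by exists O.
  by apply: open_nbhs_nbhs; split => //; exact: KW.
have [O OP] := choice box.
have : compact (set_power n K).
  exact: (@tychonoff 'I_n (fun=> X) (fun=> K) (fun=> cK)).
move=> /compact_nbhs_subcover.
move=> /(_ (fun f => [set g | forall i, O f i (g i)])) [f Kf|s sK KO].
  apply: open_nbhs_nbhs; split; last by move=> i; have [/(_ i) []] := OP f Kf.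
  by apply: (@open_box _ (fun=> X)) => i; have [/(_ i) []] := OP f Kf.
pose near_pt x y := forall (f : seq_sub s) i, O (val f) i x -> O (val f) i y.
exists [set y | exists2 x, K x & near_pt x y]; split.
- rewrite openE => y [x Kx xy]; rewrite /interior.
  suff : \forall z \near y, near_pt x z by apply: filterS => z xz; exists x.
  apply: filter_forall => f; apply: filter_forall => i.
  have [Ox|nOx] := pselect (O (val f) i x); last exact: nearW.
  have [/(_ i) [oO _] _] := OP _ (sK _ (valP f)).
  have : nbhs y (O (val f) i) by apply: open_nbhs_nbhs; split => //; exact: xy.
  exact: filterS.
- by move=> x Kx; exists x.
- move=> y Uy.
  have /choice[x xP] : forall i, exists x, K x /\ near_pt x (y i).
    by move=> i; have [x Kx xy] := Uy i; exists x.
  have [f fs fx] := KO x (fun i => (xP i).1).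
  have [_] := OP f (sK f fs); apply => i /=.
  exact: ((xP i).2 (SeqSub fs)).
Qed.

(** * The bornology of a power *)

(** The condition on [n] matters: the power of exponent zero of any set is the
    whole one-point space, which cannot belong to a bornology.  For [n]
    positive, a power of a set is everything only when the set is, by looking
    at constant tuples. *)
Lemma power_bornologyE (X : topologicalType) (B : set (set X)) (n : nat) :
  is_bornology B -> (1 <= n)%N ->
  power_bornology n B = [set A | exists2 K, B K & A `<=` set_power n K].
Proof.
move=> [Bsub Bfin Bcov BT] n1; rewrite eqEsubset; split=> [A|A [K BK AK]].
  apply; split; last by move=> _ [K BK <-]; exists K.
  split.
  - by move=> C C' [K BK CK] C'C; exists K => //; exact: subset_trans CK.
  - move=> F finF FB.
    have hF C : exists K, F C -> B K /\ C `<=` set_power n K.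
      have [/FB [K BK CK]|nFC] := pselect (F C); first by exists K.
      by exists set0.
    have [h hP] := choice hF.
    exists (\bigcup_(K in h @` F) K).
      apply: Bfin; first exact: finite_image.
      by move=> _ [C FC <-]; have [] := hP C FC.
    move=> f [C FC Cf] i; exists (h C); first by exists C.
    by have [_ Ch] := hP C FC; exact: Ch.
  - rewrite -subTset => f _.
    have hf i : exists K, B K /\ K (f i).
      have : [set: X] (f i) by [].
      by rewrite -Bcov => -[K BK Kfi]; exists K.
    have [h hP] := choice hf.
    exists (set_power n (\bigcup_(K in range h) K)).
      exists (\bigcup_(K in range h) K) => //; apply: Bfin.
        exact/finite_image/finite_finset.
      by move=> _ [i _ <-]; have [] := hP i.
    by move=> i; exists (h i); [exists i | have [] := hP i].
  - move=> [K BK TK]; apply: BT; apply: Bsub BK _ => x _.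
    exact: (TK (fun=> x) I (Ordinal n1)).
move=> M [[Msub _ _ _] BM]; apply: Msub AK; apply: BM; by exists K.
Qed.

(** * Transfer of selection principles *)

Lemma satisfies_transfer (Pi : selection_principle) (Y Z : topologicalType)
    (C : set (set Y)) (D : set (set Z)) (p : set Y -> set Z) :
  p setT = setT ->
  {homo p : K L / K `<=` L} ->
  (forall A, D A -> exists2 K, C K & A `<=` p K) ->
  (forall K, C K -> exists2 A, D A & forall W, open W -> A `<=` W ->
     exists V, [/\ open V, K `<=` V & p V `<=` W]) ->
  satisfies Pi (open_covers C) (open_covers C) ->
  satisfies Pi (open_covers D) (open_covers D).
Proof.
move=> pT pmono pcof tube.
pose refine (U : set (set Z)) : set (set Y) :=
  [set V | open V /\ exists2 W, U W & p V `<=` W].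
have refineP U : open_covers D U -> open_covers C (refine U).
  move=> [oU UT UD]; split=> [V [] //|[_ [W UW]]|K CK].
    by rewrite pT subTset => WT; apply: UT; rewrite -WT.
  have [A DA KA] := tube K CK; have [W UW AW] := UD A DA.
  have [V [oV KV VW]] := KA W (oU _ UW) AW.
  by exists V => //; split => //; exists W.
have pushP (U : nat -> set (set Z)) : exists g : nat -> set Y -> set Z,
    forall k V, refine (U k) V -> U k (g k V) /\ p V `<=` g k V.
  suff /choice[g gP] : forall k, exists g : set Y -> set Z,
      forall V, refine (U k) V -> U k (g V) /\ p V `<=` g V by exists g.
  move=> k.
  suff /choice[g gP] : forall V, exists W : set Z,
      refine (U k) V -> U k W /\ p V `<=` W by exists g.
  move=> V.
  have [[oV [W UW VW]]|nV] := pselect (refine (U k) V); last by exists set0.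
  by exists W.
(* What is common to both principles: a family [G] of members of the given
   covers that contains a set around [p V] for each [V] in a [C]-cover [H]. *)
have coverP (U : nat -> set (set Z)) (H : set (set Y)) (G : set (set Z)) :
    (forall k, open_covers D (U k)) -> G `<=` \bigcup_k U k ->
    (forall V, H V -> exists2 W, G W & p V `<=` W) ->
    open_covers C H -> open_covers D G.
  move=> UP GU HG [_ _ HC]; split.
  - by move=> W /GU [k _ UW]; have [oU _ _] := UP k; exact: oU.
  - by move=> /GU [k _ UT]; have [_ + _] := UP k; apply.
  - move=> A /pcof [K /HC [V HV KV] AK]; have [W GW VW] := HG V HV.
    exists W => //; apply: subset_trans AK _; apply: subset_trans VW.
    exact: pmono.
case: Pi => /= sel U UP; have [g gP] := pushP U;
  have [V [VU VC]] := sel (refine \o U) (fun k => refineP _ (UP k)).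
- exists (fun k => g k (V k)); split=> [k|]; first by have [] := gP k _ (VU k).
  apply: (coverP U (range V)) VC => // [_ [k _ <-]|_ [k _ <-]].
    by exists k => //; have [] := gP k _ (VU k).
  by exists (g k (V k)); [exists k | have [] := gP k _ (VU k)].
- exists (fun k => g k @` V k); split=> [k|].
    have [finV VUk] := VU k; split; first exact: finite_image.
    by move=> _ [A VA <-]; have [] := gP k _ (VUk _ VA).
  apply: (coverP U (\bigcup_k V k)) VC => // [_ [k _ [A VA <-]]|A [k _ VA]].
    by exists k => //; have [] := gP k _ ((VU k).2 _ VA).
  exists (g k A); first by exists k => //; exists A.
  by have [] := gP k _ ((VU k).2 _ VA).
Qed.

Lemma satisfies_power (Pi : selection_principle) (X : topologicalType)
    (B B0 : set (set X)) (n : nat) :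
  is_bornology B -> is_bornology_base B B0 -> is_compact_family B0 ->
  (1 <= n)%N ->
  satisfies Pi (open_covers B) (open_covers B) ->
  satisfies Pi (open_covers (power_bornology n B))
               (open_covers (power_bornology n B)).
Proof.
move=> hB [B0B B0cof] cB0 n1; rewrite power_bornologyE //.
apply: (@satisfies_transfer _ _ _ _ _ (set_power n)) => //.
- by rewrite -subTset.
- by move=> K L KL f Kf i; exact: KL.
- move=> K /B0cof [K0 B0K0 KK0].
  exists (set_power n K0); first by exists K0 => //; exact: B0B.
  move=> W oW K0W.
  have [V [oV K0V VW]] := compact_power_tube (cB0 _ B0K0) oW K0W.
  by exists V; split => //; exact: subset_trans K0V.
Qed.

Lemma satisfies_of_power (Pi : selection_principle) (X : topologicalType)
    (B : set (set X)) (n : nat) :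
  is_bornology B -> (1 <= n)%N ->
  satisfies Pi (open_covers (power_bornology n B))
               (open_covers (power_bornology n B)) ->
  satisfies Pi (open_covers B) (open_covers B).
Proof.
move=> hB n1; rewrite power_bornologyE //.
pose diag (x : X) : power_space X n := fun=> x.
apply: (@satisfies_transfer _ _ _ _ _ (preimage diag)) => //.
- by move=> K L KL x; exact: KL.
- move=> A BA; exists (set_power n A); first by exists A.
  by move=> x Ax i.
- move=> A [K BK AK]; exists K => // W oW KW; exists (set_power n W); split.
  + exact: (@open_box 'I_n (fun=> X) (fun=> W) (fun=> oW)).
  + by apply: subset_trans AK _ => f Kf i; exact: KW.
  + by move=> x /(_ (Ordinal n1)).
Qed.

Unset Implicit Arguments.
Set Strict Implicit.

Theorem theorem4p3 (Pi : selection_principle) (X : topologicalType)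
    (B B0 : set (set X)) (hB : is_bornology B) (hB0 : is_bornology_base B B0)
    (hcpt : is_compact_family B0) :
  satisfies Pi (open_covers B) (open_covers B) <->
  (forall n : nat, (1 <= n)%N ->
     satisfies Pi (open_covers (power_bornology n B))
                  (open_covers (power_bornology n B))).
Proof.
split=> [selX n n1|selXn]; first exact: satisfies_power hcpt n1 selX.
exact: satisfies_of_power hB (leqnn 1) (selXn 1 (leqnn 1)).
Qed.
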